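(* Let $n\ge2$, $c=1680$, and let $\alpha(n)>0$ be a constant depending only on $n$ such that $d_a(g,\mathcal{M})\le\alpha(n)\,\delta_a(g)^{1/(cn)}$ for every $g\in BV(\mathbb{R}^n)$ (such a constant exists). Then for every $f\in BV(\mathbb{R}^n)$ which is not $0$ a.e., $$d_a(f,\mathcal{M})\ \le\ \alpha(n)\,\delta_{aLS}(f)^{1/(cn)}.$$
   Context: $B_2^n$ is the Euclidean unit ball of $\mathbb{R}^n$, $\omega_n$ its volume, $n'=n/(n-1)$; for real $s\ge0$, $\omega_s=\pi^{s/2}/\Gamma(1+s/2)$. $\|\cdot\|_q$ is the $L^q(\mathbb{R}^n)$ norm and $\chi_S$ the characteristic function of $S$. $BV(\mathbb{R}^n)$ is the space of $f\in L^{n/(n-1)}(\mathbb{R}^n)$ whose weak gradient $Df$ is an $\mathbb{R}^n$-valued Radon measure of bounded (finite total) variation; $|Df|$ is the total variation measure and $\sigma_f$ the Radon–Nikodym derivative of $Df$ with respect to $|Df|$. $L_1$ affine energy: $$\mathcal{E}_1(f)=\frac{c_{n,1}}{2}\left(\int_{S^{n-1}}\left(\int_{\mathbb{R}^n}|\langle u,\sigma_f(x)\rangle|\,d(|Df|)(x)\right)^{-n}du\right)^{-1/n},\qquad c_{n,1}=(n\omega_n)^{1/n}\,\frac{n\omega_n\omega_0}{\omega_{n-1}}.$$ Affine Sobolev deficit: $\delta_a(f)=\dfrac{\mathcal{E}_1(f)}{n\omega_n^{1/n}\|f\|_{n'}}-1$ if $f\ne0$, $\delta_a(0)=0$. Affine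 logarithmic-Sobolev deficit: $$\delta_{aLS}(f)=\frac{\mathcal{E}_1(f)}{n\omega_n^{1/n}\|f\|_{n'}}-\frac{\|f\|_1}{\|f\|_{n'}}\exp\left(\frac1n\int_{\mathbb{R}^n}\frac{|f(x)|}{\|f\|_1}\ln\left(\frac{|f(x)|}{\|f\|_1}\right)dx\right).$$ $SL_n$ is the set of volume preserving linear transformations of $\mathbb{R}^n$, and $$\mathcal{M}=\{g_{a,x_0,\psi,r}=a\,\chi_{x_0+ar\psi(B_2^n)} : a\ne0,\ r>0,\ x_0\in\mathbb{R}^n,\ \psi\in SL_n\}.$$ For $f\ne0$, $$d_a(f,\mathcal{M})=\inf\left\{\frac{\|f-g_{a,x_0,\psi,r}\|_{n'}^{n'}}{\|f\|_{n'}^{n'}} : g_{a,x_0,\psi,r}\in\mathcal{M},\ \|f\|_{n'}=\|g_{a,x_0,\psi,r}\|_{n'}\right\},$$ and $d_a(0,\mathcal{M})=0$. *)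

(* Defs.v *)
From HB Require Import structures.
From mathcomp Require Import all_boot all_order all_algebra.
From mathcomp Require Import ring.
From mathcomp Require Import all_classical all_reals all_analysis.
From mathcomp Require Import measurable_realfun.
Import Order.TTheory GRing.Theory Num.Def Num.Theory.
Import numFieldNormedType.Exports.

Set Implicit Arguments.
Unset Strict Implicit.
Unset Printing Implicit Defensive.

Local Open Scope classical_set_scope.
Local Open Scope ring_scope.

(* R^n is 'rV[R]_n. Its library norm is the sup norm, which gives the usual
   topology and derivatives; the Euclidean norm is enorm. *)

Definition dotv {R : realType} {n} (u v : 'rV[R]_n) : R :=
  \sum_i u 0 i * v 0 i.

Definition enorm {R : realType} {n} (x : 'rV[R]_n) : R := Num.sqrt (dotv x x).

Definition ball2 (R : realType) n : set 'rV[R]_n := [set x | enorm x <= 1].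

Definition sphere (R : realType) n : set 'rV[R]_n := [set x | enorm x = 1].

Section enorm_theory.
Context {R : realType} {n : nat}.
Implicit Types u v : 'rV[R]_n.

Lemma dotv_ge0 u : 0 <= dotv u u.
Proof. by apply: sumr_ge0 => i _; rewrite -expr2 sqr_ge0. Qed.

Lemma enorm_ge0 u : 0 <= enorm u.
Proof. exact: sqrtr_ge0. Qed.

Lemma enorm0 : enorm (0 : 'rV[R]_n) = 0.
Proof.
by rewrite /enorm /dotv big1 ?sqrtr0// => i _; rewrite mxE mulr0.
Qed.

Lemma dotv_CS u v : dotv u v ^+ 2 <= dotv u u * dotv v v.
Proof.
have [v0|v0] := eqVneq (dotv v v) 0.
  have /psumr_eq0P vi0 : \sum_i v 0 i * v 0 i = 0 by exact: v0.
  rewrite v0 mulr0 /dotv big1 ?expr0n// => i _.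
  have := vi0 (fun j _ => sqr_ge0 (v 0 j)) i isT.
  by move/eqP; rewrite -expr2 sqrf_eq0 => /eqP ->; rewrite mulr0.
have vp : 0 < dotv v v by rewrite lt0r v0 dotv_ge0.
have : 0 <= \sum_i (dotv v v * u 0 i - dotv u v * v 0 i) ^+ 2.
  by apply: sumr_ge0 => i _; rewrite sqr_ge0.
have sqE B C : \sum_i (B * u 0 i - C * v 0 i) ^+ 2 =
    B ^+ 2 * dotv u u - 2 * B * C * dotv u v + C ^+ 2 * dotv v v.
  rewrite /dotv !mulr_sumr -sumrB -big_split/=.
  by apply: eq_bigr => i _; ring.
rewrite sqE [leRHS](_ : _ =
    dotv v v * (dotv u u * dotv v v - dotv u v ^+ 2)); last by ring.
by rewrite pmulr_rge0// subr_ge0.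
Qed.

Lemma enormD u v : enorm (u + v) <= enorm u + enorm v.
Proof.
rewrite -(@ler_pXn2r _ 2)// ?nnegrE ?addr_ge0 ?enorm_ge0//.
rewrite sqrrD !sqr_sqrtr ?dotv_ge0//.
have -> : dotv (u + v) (u + v) = dotv u u + dotv u v *+ 2 + dotv v v.
  rewrite mulr2n /dotv -!big_split/=; apply: eq_bigr => i _.
  by rewrite !mxE; ring.
rewrite lerD2r lerD2l ler_pMn2r//.
rewrite /enorm -sqrtrM ?dotv_ge0// (le_trans (ler_norm _))// -sqrtr_sqr.
by rewrite ler_wsqrtr// dotv_CS.
Qed.

Lemma enorm_sum (I : Type) (r : seq I) (P : pred I) (F : I -> 'rV[R]_n) :
  enorm (\sum_(i <- r | P i) F i) <= \sum_(i <- r | P i) enorm (F i).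
Proof.
elim/big_rec2 : _ => [|i x y _ yx]; first by rewrite enorm0.
by rewrite (le_trans (enormD _ _))// lerD2l.
Qed.

Lemma enorm_le_sum u : enorm u <= \sum_i `|u 0 i|.
Proof.
rewrite -(@ler_pXn2r _ 2)// ?nnegrE ?enorm_ge0 ?sumr_ge0//.
rewrite sqr_sqrtr ?dotv_ge0// expr2 mulr_suml ler_sum// => i _.
rewrite (bigD1 i)//= mulrDr -normrM (le_trans (ler_norm _))// lerDl.
by rewrite mulr_ge0// sumr_ge0.
Qed.

Lemma le_enorm u i : `|u 0 i| <= enorm u.
Proof.
rewrite -sqrtr_sqr ler_wsqrtr// /dotv (bigD1 i)//= expr2 lerDl.
by apply: sumr_ge0 => j _; rewrite -expr2 sqr_ge0.
Qed.

End enorm_theory.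

(* 'rV[R]_n carries the sigma-algebra generated by the coordinates, which is
   the Borel sigma-algebra. *)

Definition rV_display : measure_display.
Proof. exact. Qed.

Section measurable_rV.
Context {R : realType} {n : nat}.

Let coor : 'I_n -> 'rV[R]_n -> R := fun i v => v 0 i.

Let rV_set0 : g_sigma_preimage coor set0.
Proof. exact: sigma_algebra0. Qed.

Let rV_setC A : g_sigma_preimage coor A -> g_sigma_preimage coor (~` A).
Proof. exact: sigma_algebraC. Qed.

Let rV_bigcup (F : _^nat) : (forall i, g_sigma_preimage coor (F i)) ->
  g_sigma_preimage coor (\bigcup_i (F i)).
Proof. exact: sigma_algebra_bigcup. Qed.

HB.instance Definition _ := @isMeasurable.Build rV_display
  'rV[R]_n (g_sigma_preimage coor) rV_set0 rV_setC rV_bigcup.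

End measurable_rV.

Lemma measurable_coor {R : realType} n (i : 'I_n) :
  measurable_fun [set: 'rV[R]_n] (fun v => v 0 i).
Proof.
move=> _ Y mY; rewrite setTI; apply: sub_sigma_algebra => /=.
rewrite -bigcup_seq/=; exists i => /=; first by rewrite mem_index_enum.
by exists Y => //; rewrite setTI.
Qed.

Lemma measurable_fun_rV {R : realType} d (T : measurableType d) n
    (f : T -> 'rV[R]_n) :
  (forall i, measurable_fun [set: T] (fun x => f x 0 i)) ->
  measurable_fun [set: T] f.
Proof.
move=> mf.
suff : @g_sigma_preimage _ R T n (fun i x => f x 0 i) `<=` measurable.
  rewrite (@g_sigma_preimage_comp _ R n 'rV[R]_n (fun i v => v 0 i) T f).
  by move=> prefS _ A mA; apply: prefS; exists A.
apply: smallest_sub; first exact: sigma_algebra_measurable.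
rewrite -bigcup_seq; apply: bigcup_sub => i _.
by move=> A [B mB <-]; exact: mf.
Qed.

Definition cons_rV {R : realType} {n} (p : R * 'rV[R]_n) : 'rV[R]_n.+1 :=
  \row_i oapp (p.2 0) p.1 (unlift ord0 i).

Lemma measurable_cons_rV {R : realType} n :
  measurable_fun [set: R * 'rV[R]_n] (@cons_rV R n).
Proof.
apply: measurable_fun_rV => i.
under [X in measurable_fun _ X]eq_fun do rewrite mxE.
case: unliftP => [j _|_] /=; last exact: measurable_fst.
exact: (measurableT_comp (measurable_coor j) measurable_snd).
Qed.

Definition uncons_rV {R : realType} {n} (v : 'rV[R]_n.+1) : R * 'rV[R]_n :=
  (v 0 ord0, \row_i v 0 (lift ord0 i)).

Lemma measurable_uncons_rV {R : realType} n :
  measurable_fun [set: 'rV[R]_n.+1] (@uncons_rV R n).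
Proof.
apply/measurable_fun_pairP; split; first exact: (measurable_coor ord0).
apply: measurable_fun_rV => i /=.
under [X in measurable_fun _ X]eq_fun do rewrite mxE.
exact: (measurable_coor (lift ord0 i)).
Qed.

Lemma cons_rVK {R : realType} n : cancel (@cons_rV R n) uncons_rV.
Proof.
move=> [x v]; congr pair; first by rewrite mxE unlift_none.
by apply/rowP => i; rewrite !mxE liftK.
Qed.

Section lebesgue_cons.
Context {R : realType} {n : nat}.
Variable mu : {sigma_finite_measure set 'rV[R]_n -> \bar R}.
Local Open Scope ereal_scope.

Definition lebesgue_cons : set 'rV[R]_n.+1 -> \bar R :=
  pushforward (@lebesgue_measure R \x mu) (@cons_rV R n).

Let mcons A : measurable A -> measurable (@cons_rV R n @^-1` A).
Proof. by move=> mA; rewrite -[X in measurable X]setTI; exact: measurable_cons_rV. Qed.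

Let lebesgue_cons0 : lebesgue_cons set0 = 0.
Proof. by rewrite /lebesgue_cons /pushforward preimage_set0 measure0. Qed.

Let lebesgue_cons_ge0 A : 0 <= lebesgue_cons A.
Proof. by rewrite /lebesgue_cons /pushforward measure_ge0. Qed.

Let lebesgue_cons_sigma_additive : semi_sigma_additive lebesgue_cons.
Proof.
move=> F mF tF mUF; rewrite /lebesgue_cons /pushforward preimage_bigcup.
apply: measure_semi_sigma_additive.
- by move=> k; exact: mcons.
- apply/trivIsetP => /= i j _ _ ij; rewrite -preimage_setI.
  by move/trivIsetP : tF => /(_ _ _ _ _ ij) ->//; rewrite preimage_set0.
- by rewrite -preimage_bigcup; exact: mcons.
Qed.

HB.instance Definition _ := isMeasure.Build _ _ _ lebesgue_cons
  lebesgue_cons0 lebesgue_cons_ge0 lebesgue_cons_sigma_additive.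

Let lebesgue_cons_sigma_finite : sigma_finite setT lebesgue_cons.
Proof.
have /sigma_finiteP[F [TF ndF Foo]] := sigma_finiteT (@lebesgue_measure R).
have /sigma_finiteP[G [TG ndG Goo]] := sigma_finiteT mu.
have mFG k : measurable (F k `*` G k).
  by apply: measurableX; [have [] := Foo k|have [] := Goo k].
exists (fun k => uncons_rV @^-1` (F k `*` G k)).
  rewrite -preimage_bigcup (_ : \bigcup_k _ = setT) ?preimage_setT//.
  rewrite -setXTT TF TG predeqE => -[x y]; split => /=.
    by move=> [k _ []/= ? ?]; split; exists k.
  move=> [/= [k _ Fkx] [l _ Gly]]; exists (maxn k l) => //; split.
  - by move: x Fkx; exact/subsetPset/ndF/leq_maxl.
  - by move: y Gly; exact/subsetPset/ndG/leq_maxr.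
move=> k; split.
  by rewrite -[X in measurable X]setTI; exact: (@measurable_uncons_rV R n _ _ (mFG k)).
rewrite /lebesgue_cons /pushforward -comp_preimage.
rewrite (_ : _ \o _ = id); last by apply/funext => p /=; rewrite cons_rVK.
have [? ?] := Foo k; have [? ?] := Goo k.
by rewrite /= product_measure1E// lte_mul_pinfty// ge0_fin_numE.
Qed.

HB.instance Definition _ := Measure_isSigmaFinite.Build _ _ _ lebesgue_cons
  lebesgue_cons_sigma_finite.

End lebesgue_cons.

Fixpoint lebesgue_rV (R : realType) n :
    {sigma_finite_measure set 'rV[R]_n -> \bar R} :=
  if n is m.+1 then lebesgue_cons (lebesgue_rV R m) else \d_(0 : 'rV[R]_0).

Lemma lebesgue_rV_box (R : realType) n (A : 'I_n -> set R) :
  (forall i, measurable (A i)) ->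
  lebesgue_rV R n [set v | forall i, A i (v 0 i)] =
  (\prod_i @lebesgue_measure R (A i))%E.
Proof.
elim: n A => [|n IHn] A mA.
  rewrite big_ord0/= diracE mem_set//; by case.
rewrite big_ord_recl.
pose B := [set v : 'rV[R]_n | forall i, A (lift ord0 i) (v 0 i)].
transitivity ((@lebesgue_measure R \x lebesgue_rV R n)%E (A ord0 `*` B)).
  congr ((_ \x _)%E _); apply/seteqP; split => -[x v] /=.
    move=> Av; split => /= [|i].
      by have := Av ord0; rewrite mxE unlift_none.
    by have := Av (lift ord0 i); rewrite mxE liftK.
  by move=> [/= Ax Av] i; rewrite mxE; case: unliftP => [j ->|->] //=; exact: Av.
have mB : measurable B.
  rewrite (_ : B = \bigcap_(i in [set: 'I_n])
      ((fun v : 'rV[R]_n => v 0 i) @^-1` A (lift ord0 i))); last first.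
    by apply/seteqP; split => [v Av i _|v Av i] //=; exact: Av.
  apply: fin_bigcap_measurable => // i _.
  by rewrite -[X in measurable X]setTI; exact: (measurable_coor i _ (mA _)).
have := @product_measure1E _ _ _ _ R (@lebesgue_measure R) (lebesgue_rV R n) _ _ (mA ord0) mB => /= ->; congr (_ * _)%E; exact: IHn.
Qed.

(* An R^n-valued measure of bounded variation is given by its components,
   which are charges (finite signed measures). *)

Section total_variation.
Context d (T : measurableType d) (R : realType) (n : nat).
Variable nu : 'I_n -> {charge set T -> \bar R}.
Local Open Scope ereal_scope.

Definition vcharge (A : set T) : 'rV[R]_n := \row_i fine (nu i A).

Definition variation_sums (A : set T) : set (\bar R) :=
  [set s | exists F : (set T)^nat,
    [/\ forall k, measurable (F k), trivIset setT F, \bigcup_k F k = A &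
        s = \sum_(k <oo) (enorm (vcharge (F k)))%:E]].

(* the element 0 only matters for nonmeasurable sets, which have no
   measurable partition *)
Definition total_variation (A : set T) : \bar R :=
  ereal_sup (0 |` variation_sums A).

Let vnorm_ge0 A : 0 <= (enorm (vcharge A))%:E.
Proof. by rewrite lee_fin enorm_ge0. Qed.

Let vnorm0 : (enorm (vcharge set0))%:E = 0.
Proof.
rewrite (_ : vcharge set0 = 0%R) ?enorm0//.
by apply/rowP => i; rewrite !mxE charge0.
Qed.

Let cvg_enorm (u : nat -> 'rV[R]_n) (v : 'rV[R]_n) :
  (forall i, u k 0%R i @[k --> \oo] --> v 0%R i) ->
  enorm (u k) @[k --> \oo] --> enorm v.
Proof.
move=> uv; apply: (@continuous_cvg _ _ _ _ _ (fun k => dotv (u k) (u k)) (@sqrtr R)).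
  exact: sqrt_continuous.
rewrite /dotv; apply: cvg_big => [|i _]; first exact: add_continuous.
by apply: cvgM; exact: uv.
Qed.

Let vnorm_bigcup (F : (set T)^nat) : (forall k, measurable (F k)) ->
  trivIset setT F ->
  (enorm (vcharge (\bigcup_k F k)))%:E <=
  \sum_(k <oo) (enorm (vcharge (F k)))%:E.
Proof.
move=> mF tF; set S := (X in _ <= X).
have mUF : measurable (\bigcup_k F k) by exact: bigcup_measurable.
have cvgF : (enorm (\sum_(0 <= k < N) vcharge (F k))%R)%:E @[N --> \oo] -->
    (enorm (vcharge (\bigcup_k F k)))%:E.
  apply: cvg_EFin; first exact: nearW.
  apply: cvg_enorm => i; rewrite mxE.
  have nuF := @charge_semi_sigma_additive _ _ _ (nu i) F mF tF mUF.
  rewrite -(@fineK _ (nu i _)) in nuF; last exact: fin_num_measure.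
  apply: cvg_trans (fine_cvg nuF); apply: near_eq_cvg; apply: nearW => N /=.
  rewrite summxE -sum_fine//; last by move=> k _; exact: fin_num_measure.
  by apply: eq_bigr => k _; rewrite mxE.
rewrite -(cvg_lim _ cvgF)//; apply: lime_le.
  by apply/cvg_ex; eexists; exact: cvgF.
apply: nearW => N; apply: (@le_trans _ _
    (\sum_(0 <= k < N) (enorm (vcharge (F k)))%:E)).
  by rewrite sumEFin lee_fin enorm_sum.
exact: nneseries_lim_ge.
Qed.

Let total_variation_ubound A s : variation_sums A s -> s <= total_variation A.
Proof. by move=> As; apply: ereal_sup_ubound; right. Qed.

Lemma total_variation_ge0 A : 0 <= total_variation A.
Proof. by apply: ereal_sup_ubound; left. Qed.

Lemma total_variation0 : total_variation set0 = 0.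
Proof.
apply/eqP; rewrite eq_le total_variation_ge0 andbT.
apply: ge_ereal_sup => _ [->//|[F [_ _ F0 ->]]].
rewrite eseries0// => k _ _.
rewrite (_ : F k = set0) ?vnorm0// -subset0 -F0.
exact: bigcup_sup.
Qed.

Lemma total_variation_lty A : measurable A -> total_variation A < +oo.
Proof.
move=> mA.
have /choice[m mP] (i : 'I_n) : exists m : {measure set T -> \bar R},
    m A < +oo /\ forall B, measurable B -> `|nu i B| <= m B.
  have [P [N nuPN]] := Hahn_decomposition (nu i).
  exists (charge_variation nuPN); split.
    by rewrite ltey_eq /charge_variation fin_numD !fin_num_measure.
  by move=> B mB; exact: abse_charge_variation.
apply: (@le_lt_trans _ _ (\sum_(i < n) m i A)); last first.
  by apply: lte_sum_pinfty => i _; have [] := mP i.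
apply: ge_ereal_sup => _ [->|[F [mF tF FA ->]]].
  by apply: sume_ge0 => i _; exact: measure_ge0.
apply: (@le_trans _ _ (\sum_(k <oo) \sum_(i < n) m i (F k))).
  apply: lee_nneseries => // k _.
  apply: (@le_trans _ _ (\sum_(i < n) `|nu i (F k)|)); last first.
    by apply: lee_sum => i _; have [_] := mP i; apply.
  apply: (@le_trans _ _ (\sum_(i < n) `|vcharge (F k) 0%R i|)%:E).
    by rewrite lee_fin enorm_le_sum.
  rewrite -sumEFin lee_sum// => i _; rewrite mxE -fine_abse ?fin_num_measure//.
  by rewrite fineK// abse_fin_num fin_num_measure.
rewrite nneseries_sum//; apply: lee_sum => i _.
by rewrite -FA -measure_semi_bigcup// FA.
Qed.

Let total_variationU A B : measurable A -> measurable B -> A `&` B = set0 ->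
  total_variation A + total_variation B <= total_variation (A `|` B).
Proof.
move=> mA mB AB0.
have mAB : measurable (A `|` B) by exact: measurableU.
have fin C : measurable C -> total_variation C \is a fin_num.
  by move=> mC; rewrite ge0_fin_numE ?total_variation_lty ?total_variation_ge0.
have part C : measurable C -> variation_sums C (enorm (vcharge C))%:E.
  move=> mC; exists (fun k => if k is 0%N then C else set0); split.
  - by case.
  - by apply/trivIsetP => -[|i] [|j] _ _ //=; rewrite ?setI0 ?set0I.
  - apply/seteqP; split => [x [[|k] _]//|x Cx]; by exists 0%N.
  - rewrite (nneseries_split 0 1)//= big_nat1 eseries0 ?adde0//.
    by case.
have le0 C s : measurable C -> (0 |` variation_sums C) s ->
    exists2 t, s <= t & variation_sums C t.
  by move=> mC [->|Cs]; [exists (enorm (vcharge C))%:E => //; exact: part|exists s].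
rewrite -leeBrDr ?fin//; apply: ge_ereal_sup => s /(le0 _ _ mA)[{}s' ss'].
move=> [F [mF tF FA s'E]]; apply: (le_trans ss'); rewrite leeBrDr ?fin//.
have s'0 : 0 <= s' by rewrite s'E; apply: nneseries_ge0.
have s'fin : s' \is a fin_num.
  rewrite ge0_fin_numE// (le_lt_trans _ (total_variation_lty mA))//.
  by apply: total_variation_ubound; exists F.
rewrite addeC -leeBrDr//; apply: ge_ereal_sup => t /(le0 _ _ mB)[{}t' tt'].
move=> [G [mG tG GB t'E]]; apply: (le_trans tt'); rewrite leeBrDr//.
pose H k := if odd k then G k./2 else F k./2.
have FGd i j : F i `&` G j = set0.
  rewrite -subset0 -AB0 -FA -GB; apply: setISS; exact: bigcup_sup.
apply: (@le_trans _ _ (\sum_(k <oo) (enorm (vcharge (H k)))%:E)); last first.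
  apply: total_variation_ubound; exists H; split => //.
  - by move=> k; rewrite /H; case: ifP.
  - apply/trivIsetP => i j _ _ ij; rewrite /H.
    have h : odd i = odd j -> i./2 != j./2.
      move=> oij; apply: contra ij => /eqP hij.
      by rewrite -(odd_double_half i) -(odd_double_half j) oij hij.
    case: ifPn => oi; case: ifPn => oj.
    + by move/trivIsetP : tG; apply => //; apply: h; rewrite oi oj.
    + by rewrite setIC FGd.
    + by rewrite FGd.
    + move/trivIsetP : tF; apply => //; apply: h.
      by rewrite (negbTE oi) (negbTE oj).
  - apply/seteqP; split => x.
      move=> [k _]; rewrite /H; case: ifP => _ Hx.
        by right; rewrite -GB; exists k./2.
      by left; rewrite -FA; exists k./2.
    rewrite -FA -GB => -[[k _ Fx]|[k _ Gx]].
      by exists k.*2 => //; rewrite /H odd_double doubleK.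
    by exists k.*2.+1 => //; rewrite /H /= odd_double/= uphalf_double.
rewrite addeC s'E t'E -nneseriesD//; apply: lime_le.
  by apply: is_cvg_nneseries => k _ _; exact: adde_ge0.
apply: nearW => N; rewrite (@le_trans _ _
    (\sum_(0 <= k < N.*2) (enorm (vcharge (H k)))%:E))//; last first.
  exact: nneseries_lim_ge.
elim: N => [|N IHN]; first by rewrite !big_geq.
rewrite doubleS !big_nat_recr//= -addeA leeD// leeD//.
  by rewrite /H odd_double doubleK.
by rewrite /H /= odd_double/= uphalf_double.
Qed.

Let le_total_variation A B : measurable A -> measurable B -> A `<=` B ->
  total_variation A <= total_variation B.
Proof.
move=> mA mB AB; rewrite -(setDUK AB).
apply: le_trans (total_variationU mA _ _).
- by rewrite leeDl// total_variation_ge0.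
- exact: measurableD.
- by rewrite setDIK.
Qed.

Lemma total_variation_semi_sigma_additive :
  semi_sigma_additive total_variation.
Proof.
move=> A mA tA mUA.
have tv0 k : 0 <= total_variation (A k) by exact: total_variation_ge0.
rewrite [X in _ --> X](_ : _ = \sum_(k <oo) total_variation (A k)).
  exact: is_cvg_nneseries.
apply/eqP; rewrite eq_le; apply/andP; split.
  apply: ge_ereal_sup => _ [->|[F [mF tF FA ->]]]; first exact: nneseries_ge0.
  have mFA k i : measurable (F k `&` A i) by exact: measurableI.
  apply: (@le_trans _ _ (\sum_(k <oo) \sum_(i <oo)
      (enorm (vcharge (F k `&` A i)))%:E)).
    apply: lee_nneseries => // k _.
    rewrite (_ : F k = \bigcup_i (F k `&` A i)); last first.
      by rewrite -setI_bigcupr -FA; apply/esym/setIidl; exact: bigcup_sup.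
    rewrite [leRHS](_ : _ = \sum_(i <oo) (enorm (vcharge (F k `&` A i)))%:E).
      by apply: vnorm_bigcup => //; exact: trivIset_setIl.
    by rewrite -setI_bigcupr -FA setIidl//; exact: bigcup_sup.
  rewrite nneseries_interchange//; apply: lee_nneseries => [i _ _|i _].
    exact: nneseries_ge0.
  apply: total_variation_ubound; exists (fun k => F k `&` A i); split => //.
  - exact: trivIset_setIr.
  - by rewrite -setI_bigcupl FA setIidr//; exact: bigcup_sup.
apply: lime_le; first exact: is_cvg_nneseries.
apply: nearW => N; rewrite (@le_trans _ _
    (total_variation (\big[setU/set0]_(k < N) A k)))//; last first.
  apply: le_total_variation => //; first exact: bigsetU_measurable.
  exact: bigsetU_bigcup.
elim: N => [|N IHN]; first by rewrite big_geq// big_ord0 total_variation0.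
rewrite big_nat_recr//= big_ord_recr/=.
apply: le_trans (total_variationU _ _ _) => //; first by rewrite leeD2r.
  exact: bigsetU_measurable.
rewrite -bigcup_mkord setI_bigcupl bigcup0// => k /= kN.
by move/trivIsetP : tA; apply => //; rewrite ltn_eqF.
Qed.

HB.instance Definition _ := isMeasure.Build _ _ _ total_variation
  total_variation0 total_variation_ge0 total_variation_semi_sigma_additive.

Let total_variation_fin : fin_num_fun total_variation.
Proof.
by move=> A mA; rewrite ge0_fin_numE ?total_variation_lty ?total_variation_ge0.
Qed.

HB.instance Definition _ := Measure_isFinite.Build _ _ _ total_variation
  total_variation_fin.

Lemma dominates_total_variation i : nu i `<< total_variation.
Proof.
apply/null_content_dominatesP => A mA tvA0.
have : (enorm (vcharge A))%:E <= 0.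
  rewrite -tvA0; apply: total_variation_ubound.
  exists (fun k => if k is 0%N then A else set0); split.
  - by case.
  - by apply/trivIsetP => -[|j] [|k] _ _ //=; rewrite ?setI0 ?set0I.
  - apply/seteqP; split => [x [[|k] _]//|x Ax]; by exists 0%N.
  - rewrite (nneseries_split 0 1)//= big_nat1 eseries0 ?adde0//.
    by case.
rewrite lee_fin => /(le_trans (le_enorm (vcharge A) i)).
rewrite normr_le0 mxE => /eqP h.
by rewrite -(@fineK _ (nu i A)) ?h// fin_num_measure.
Qed.

End total_variation.

Local Open Scope charge_scope.

Definition partial {R : realType} {n} (i : 'I_n) (phi : 'rV[R]_n -> R) :
  'rV[R]_n -> R := fun x => 'D_(delta_mx 0 i) phi x.

(* C^oo: all iterated partial derivatives are differentiable *)
Definition smooth {R : realType} {n} (phi : 'rV[R]_n -> R) : Prop :=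
  forall (s : seq 'I_n) x, differentiable (foldr partial phi s) x.

Definition test_function {R : realType} {n} (phi : 'rV[R]_n -> R) : Prop :=
  smooth phi /\ compact (closure [set x | phi x != 0]).

(* the density sigma in the polar decomposition nu = sigma |nu|; the
   derivative exists by dominates_total_variation *)
Definition polar {d} {T : measurableType d} {R : realType} {n}
    (nu : 'I_n -> {charge set T -> \bar R}) (x : T) : 'rV[R]_n :=
  \row_i fine (('d (nu i) '/d (total_variation nu)) x).

Section bounded_variation.
Context {R : realType} {n : nat}.
Implicit Types f : 'rV[R]_n -> R.
Local Open Scope ereal_scope.

(* the integral of phi with respect to the i-th component of nu = sigma |nu|
   is the integral of phi sigma_i with respect to |nu| *)
Definition is_weak_gradient f (nu : 'I_n -> {charge set 'rV[R]_n -> \bar R}) :=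
  forall phi : 'rV[R]_n -> R, test_function phi -> forall i,
    \int[lebesgue_rV R n]_x (f x * partial i phi x)%:E =
    - \int[total_variation nu]_x (phi x * polar nu x 0%R i)%:E.

(* n' = n / (n - 1) *)
Definition sobolev_conj (n : nat) : R := n%:R / (n%:R - 1).

Definition BV f : Prop :=
  f \in Lfun (lebesgue_rV R n) (sobolev_conj n)%:E /\
  exists2 nu, is_weak_gradient f nu & total_variation nu setT < +oo.

Definition weak_gradient f : 'I_n -> {charge set 'rV[R]_n -> \bar R} :=
  if pselect (exists nu, is_weak_gradient f nu) is left h then sval (cid h)
  else fun=> czero.

End bounded_variation.

Section sphere_measure.
Context {R : realType} {n : nat}.
Local Open Scope ereal_scope.

Lemma measurable_enorm : measurable_fun [set: 'rV[R]_n] (@enorm R n).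
Proof.
apply: (@measurableT_comp _ _ _ _ _ _ (@sqrtr R)).
  apply: continuous_measurable_fun; exact: sqrt_continuous.
have msum (r : seq 'I_n) : measurable_fun [set: 'rV[R]_n]
    (fun x => \sum_(i <- r) x 0 i * x 0 i)%R.
  elim: r => [|i r IHr].
    under [X in measurable_fun _ X]eq_fun do rewrite big_nil.
    exact: measurable_cst.
  under [X in measurable_fun _ X]eq_fun do rewrite big_cons.
  by apply: measurable_funD => //; apply: measurable_funM;
    exact: (measurable_coor i).
exact: msum.
Qed.

Definition cone (A : set 'rV[R]_n) : set 'rV[R]_n :=
  [set x | (enorm x <= 1)%R /\ A ((enorm x)^-1 *: x)%R].

(* On the unit sphere this is the (unnormalized) surface measure, of total mass
   n omega_n: the surface area of A is n times the volume of the part of the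
   unit ball lying over A. *)
Definition sphere_measure (A : set 'rV[R]_n) : \bar R :=
  n%:R%:E * lebesgue_rV R n (cone A).

Lemma measurable_cone A : measurable A -> measurable (cone A).
Proof.
move=> mA.
rewrite (_ : cone A = @enorm R n @^-1` `]-oo, 1%R] `&`
    (fun x => (enorm x)^-1 *: x)%R @^-1` A); last first.
  by apply/seteqP; split => x; rewrite /cone /= in_itv.
apply: measurableI; rewrite -[X in measurable X]setTI.
  by apply: measurable_enorm => //; exact: measurable_itv.
apply: measurable_fun_rV => // i.
under [X in measurable_fun _ X]eq_fun do rewrite mxE.
apply: measurable_funM; last exact: (measurable_coor i).
under [X in measurable_fun _ X]eq_fun do rewrite -powR_inv1 ?enorm_ge0//.
exact: (measurableT_comp (measurable_powR _) measurable_enorm).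
Qed.

Let sphere_measure0 : sphere_measure set0 = 0.
Proof.
rewrite /sphere_measure (_ : cone set0 = set0) ?measure0 ?mule0//.
by apply/seteqP; split => x // -[].
Qed.

Let sphere_measure_ge0 A : 0 <= sphere_measure A.
Proof. by rewrite mule_ge0. Qed.

Let sphere_measure_sigma_additive : semi_sigma_additive sphere_measure.
Proof.
move=> F mF tF mUF; rewrite /sphere_measure.
rewrite (_ : cone _ = \bigcup_k cone (F k)); last first.
  apply/seteqP; split => x /=.
    by move=> [x1 [k _ Fx]]; exists k.
  by move=> [k _ [x1 Fx]]; split => //; exists k.
under eq_fun do rewrite -ge0_sume_distrr//.
apply: cvgeZl => //; apply: measure_semi_sigma_additive.
- by move=> k; exact: measurable_cone.
- apply/trivIsetP => i j _ _ ij; rewrite -subset0 => x -[[_ Fi] [_ Fj]].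
  have /trivIsetP /(_ i j I I ij) FF := tF.
  by have : (F i `&` F j) ((enorm x)^-1 *: x)%R by []; rewrite FF.
- by apply: bigcup_measurable => k _; exact: measurable_cone.
Qed.

HB.instance Definition _ := isMeasure.Build _ _ _ sphere_measure
  sphere_measure0 sphere_measure_ge0 sphere_measure_sigma_additive.

End sphere_measure.

Definition Gamma {R : realType} (x : R) : R :=
  (\int[lebesgue_measure]_(t in `]0%R, +oo[) (t `^ (x - 1) * expR (- t)))%R.

Definition omega {R : realType} (s : R) : R := pi `^ (s / 2) / Gamma (1 + s / 2).

(* Bases below 0 are sent to 0, as for Num.sqrt, whereas powR sends them to 1.
   Both deficits are nonnegative by the affine Sobolev inequality. *)
Definition pospow {R : realType} (x : \bar R) (p : R) : \bar R :=
  (maxe 0 x `^ p)%E.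

Section affine_energy.
Context {R : realType} {n : nat}.
Implicit Types f g : 'rV[R]_n -> R.
Local Open Scope ereal_scope.

Local Notation lambda := (lebesgue_rV R n).
Local Notation n' := (@sobolev_conj R n).
Local Notation norm p f := ('N[lambda]_(p%R%:E)[EFin \o f]).

Definition c_n1 : R :=
  ((n%:R * omega n%:R) `^ n%:R^-1 *
   (n%:R * omega n%:R * omega 0 / omega (n%:R - 1)))%R.

(* Negative powers are written as inverses, so that 0^-1 = +oo and
   +oo^-1 = 0. *)
Definition affine_energy f : \bar R :=
  let Df := weak_gradient f in
  (c_n1 / 2)%:E *
  ((\int[sphere_measure]_(u in @sphere R n)
      ((\int[total_variation Df]_x `|dotv u (polar Df x)|%:E) ^+ n)^-1)
    `^ n%:R^-1)^-1.

Definition ae_zero f : Prop := {ae lambda, forall x, f x = 0%R}.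

Definition sobolev_quotient f : \bar R :=
  affine_energy f / ((n%:R * omega n%:R `^ n%:R^-1)%R%:E * norm n' f).

Definition affine_deficit f : \bar R :=
  if pselect (ae_zero f) then 0 else sobolev_quotient f - 1.

(* int |f| / |f|_1 ln (|f| / |f|_1), which may be -oo; 0 ln 0 = 0 since ln 0 = 0 *)
Definition entropy f : \bar R :=
  let p x := (`|f x| / fine (norm 1 f))%R in
  \int[lambda]_x (p x * ln (p x))%:E.

(* If f is not in L^1, the subtracted term is 0, which is its limit along the
   truncations of f to balls. *)
Definition log_deficit f : \bar R :=
  sobolev_quotient f -
  (if norm 1 f == +oo then 0 else
   norm 1 f / norm n' f * expeR (n%:R^-1%:E * entropy f)).

Definition ellipsoid_fun (a : R) (x0 : 'rV[R]_n) (psi : 'M[R]_n) (r : R) :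
    'rV[R]_n -> R :=
  fun x => (a * \1_[set x0 + (a * r) *: (y *m psi) | y in @ball2 R n] x)%R.

Definition extremals : set ('rV[R]_n -> R) :=
  [set g | exists a x0 psi r,
    [/\ a != 0%R, (0 < r)%R, \det psi = 1%R & g = ellipsoid_fun a x0 psi r]].

Definition affine_dist f : \bar R :=
  if pselect (ae_zero f) then 0 else
  ereal_inf [set (norm n' (f \- g)%R) `^ n' / (norm n' f) `^ n'
            | g in [set g | extremals g /\ norm n' f = norm n' g]].

End affine_energy.

(* Main.v *)
Require Import Defs.
From mathcomp Require Import all_boot all_order all_algebra.
From mathcomp Require Import ring lra.
From mathcomp Require Import all_classical all_reals all_analysis.
From mathcomp Require Import measurable_realfun.
Import Order.TTheory GRing.Theory Num.Theory.
Import numFieldNormedType.Exports.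

Set Implicit Arguments.
Unset Strict Implicit.
Unset Printing Implicit Defensive.

Local Open Scope classical_set_scope.
Local Open Scope ring_scope.

(** Both deficits subtract something from the same Sobolev quotient: the affine
Sobolev deficit subtracts 1, the logarithmic one subtracts
X = (|f|_1 / |f|_q) exp ((1/n) Ent), where q = n' satisfies 1/n = 1 - 1/q.  It
is therefore enough that X <= 1: then the affine deficit is at most the
logarithmic one, and x |-> alpha x^(1/(cn)) is nondecreasing.

That X <= 1 is Jensen's inequality for the logarithm under the probability
density p = |f| / |f|_1.  Writing K = |p|_q = |f|_q / |f|_1, it says that
(q - 1) int p ln p = int p ln (p^(q-1)) <= ln (int p^q) = q ln K.  The proof
integrates the tangent line inequality ln t <= t - 1 at t = (p/K)^q / p
([xlnx_le]), whose right-hand side multiplied by p has integral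
int (p/K)^q - int p = 0 ([entropy_bound]).  The entropy of a density in L^q can
be -oo, so this integration is done in the extended reals
([le_integral_ereal]).

When |f|_1 = +oo the subtracted term is 0, and X <= 1 is immediate. *)

(** The integral is by definition the difference of the integrals of the
positive and negative parts.  The first is monotone in the function, the second
antitone, and subtraction of extended reals respects this even at oo - oo.  This
is what allows comparing p ln p, whose integral can be -oo, with an integrable
bound. *)
Lemma le_integral_ereal d (T : measurableType d) (R : realType)
    (mu : {measure set T -> \bar R}) (g h : T -> \bar R) :
  measurable_fun setT g -> measurable_fun setT h ->
  (forall x, g x <= h x)%E -> (\int[mu]_x g x <= \int[mu]_x h x)%E.
Proof.
move=> mg mh gh; rewrite integralE [leRHS]integralE; apply: leeB.
- apply: ge0_le_integral => //; [exact: measurable_funepos..|].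
  by move=> x _; apply: (@funepos_le _ _ setT) => [y _|]; rewrite ?inE.
- apply: ge0_le_integral => //; [exact: measurable_funeneg..|].
  by move=> x _; apply: (@funeneg_le _ _ setT) => [y _|]; rewrite ?inE.
Qed.

(** The tangent line inequality ln t <= t - 1 at t = (p / K)^q / p, multiplied
by p. *)
Lemma xlnx_le (R : realType) (q K p : R) : 1 < q -> 0 < K -> 0 <= p ->
  (q - 1) * (p * ln p) <= (q * ln K - 1) * p + K `^ (- q) * p `^ q.
Proof.
move=> q1 K0; rewrite le_eqVlt => /predU1P[<-|p0].
  by rewrite powR0 ?gt_eqF ?(lt_trans _ q1)// !(mul0r, mulr0) addr0.
have Kq0 : 0 < K `^ (- q) by rewrite powR_gt0.
have pq0 : 0 < p `^ q by rewrite powR_gt0.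
have t0 : 0 < K `^ (- q) * p `^ q / p by rewrite divr_gt0// mulr_gt0.
have := @le_ln1Dx R (K `^ (- q) * p `^ q / p - 1).
rewrite ltrBrDr addNr => /(_ t0); rewrite addrC subrK.
rewrite lnM ?posrE ?invr_gt0 ?mulr_gt0// lnV ?posrE// lnM ?posrE//.
rewrite !ln_powR => /(ler_wpM2l (ltW p0)).
have -> : p * (K `^ (- q) * p `^ q / p - 1) = K `^ (- q) * p `^ q - p.
  by rewrite mulrBr mulr1 mulrC divfK ?gt_eqF.
by lra.
Qed.

(** Integrating [xlnx_le] gives (q - 1) int p ln p <= q ln K, because the terms
- p and (p / K)^q contribute -1 and 1.  Dividing by q puts it in the form
1 - 1/q, which for q = n' is the factor 1/n of the logarithmic deficit. *)
Lemma entropy_bound d (T : measurableType d) (R : realType)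
    (mu : {measure set T -> \bar R}) (q K : R) (p : T -> R) :
  1 < q -> 0 < K -> measurable_fun setT p -> (forall x, 0 <= p x) ->
  (\int[mu]_x (p x)%:E = 1)%E -> (\int[mu]_x (p x `^ q)%:E = (K `^ q)%:E)%E ->
  ((1 - q^-1)%:E * \int[mu]_x (p x * ln (p x))%:E <= (ln K)%:E)%E.
Proof.
move=> q1 K0 mp p0 intp intpq.
have q0 : 0 < q by exact: lt_trans q1.
have s0 : 0 < q - 1 by rewrite subr_gt0.
have mpq : measurable_fun setT (fun x => p x `^ q).
  exact: (measurableT_comp (measurable_powR q)).
have ip : mu.-integrable setT (fun x => (p x)%:E).
  apply/integrableP; split; first exact/measurable_EFinP.
  by under eq_integral do rewrite gee0_abs ?lee_fin//; rewrite intp ltry.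
have ipq : mu.-integrable setT (fun x => (p x `^ q)%:E).
  apply/integrableP; split; first exact/measurable_EFinP.
  by under eq_integral do rewrite gee0_abs ?lee_fin ?powR_ge0//; rewrite intpq ltry.
(* a p + b p^q is the bound of xlnx_le on p ln p. *)
pose a := (q - 1)^-1 * (q * ln K - 1); pose b := (q - 1)^-1 * K `^ (- q).
have -> : ln K = (1 - q^-1) * (a + b * K `^ q).
  by rewrite /a /b powRN; field; rewrite !gt_eqF ?powR_gt0.
rewrite EFinM lee_wpmul2l ?lee_fin ?subr_ge0 ?invf_le1 ?(ltW q1)//.
have -> : (a + b * K `^ q)%:E =
    (\int[mu]_x (a%:E * (p x)%:E + b%:E * (p x `^ q)%:E))%E.
  rewrite integralD//=; [|exact: integrableZl..].
  by rewrite !integralZl//= intp intpq mule1 -EFinM -EFinD.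
apply: le_integral_ereal.
- apply/measurable_EFinP; apply: measurable_funM => //.
  exact: (measurableT_comp (@measurable_ln R)).
- apply/measurable_EFinP; apply: measurable_funD; exact: measurable_funM.
- move=> x; rewrite -!EFinM -EFinD lee_fin /a /b -!mulrA -mulrDr.
  by rewrite ler_pdivlMl// xlnx_le.
Qed.

Lemma Lnorm_gt0 d (T : measurableType d) (R : realType)
    (mu : {measure set T -> \bar R}) (r : R) (f : T -> R) :
  0 < r -> measurable_fun setT f -> ~ {ae mu, forall x, f x = 0} ->
  (0 < 'N[mu]_(r%:E)[EFin \o f])%E.
Proof.
move=> r0 mf f0; rewrite lt0e Lnorm_ge0 andbT; apply/eqP => N0; apply: f0.
have mEf : measurable_fun setT (EFin \o f) by exact/measurable_EFinP.
have := Lnorm_eq0_eq0 mEf _ N0; rewrite lte_fin => /(_ r0).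
by apply: filterS => x /= /(_ I) [].
Qed.

(** The exponential of [entropy_bound] for p = |f| / |f|_1 and
K = |p|_q = |f|_q / |f|_1. *)
Lemma Lnorm_quotient_entropy_le1 d (T : measurableType d) (R : realType)
    (mu : {measure set T -> \bar R}) (q : R) (f : T -> R) :
  1 < q -> measurable_fun setT f -> ~ {ae mu, forall x, f x = 0} ->
  ('N[mu]_(q%:E)[EFin \o f] < +oo)%E -> ('N[mu]_1[EFin \o f] < +oo)%E ->
  let p x := `|f x| / fine 'N[mu]_1[EFin \o f] in
  ('N[mu]_1[EFin \o f] / 'N[mu]_(q%:E)[EFin \o f] *
   expeR ((1 - q^-1)%:E * \int[mu]_x (p x * ln (p x))%:E) <= 1)%E.
Proof.
move=> q1 mf f0 Nqoo N1oo.
have q0 : 0 < q by exact: lt_trans q1.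
have := Lnorm_gt0 q0 mf f0; have := Lnorm_gt0 ltr01 mf f0.
have := @poweR_Lnorm _ _ _ mu (EFin \o f) q (lt0r_neq0 q0).
have := Lnorm1 mu (EFin \o f).
case: ('N[mu]_1[_])%E N1oo => //= N1 _ intf.
case: ('N[mu]_(q%:E)[_])%E Nqoo => //= Nq _ intfq.
rewrite !lte_fin => N10 Nq0.
have Ni0 : 0 <= N1^-1 by rewrite invr_ge0 ltW.
have mabs : measurable_fun setT (fun x => `|f x|) by exact: measurableT_comp.
have mabsq : measurable_fun setT (fun x => `|f x| `^ q).
  exact: (measurableT_comp (measurable_powR q)).
have K0 : 0 < Nq / N1 by rewrite divr_gt0.
rewrite inver gt_eqF// -EFinM.
set Ent := (\int[mu]_x _)%E.
(* N1 / Nq is the inverse of K = Nq / N1, so the claim is exp (...) <= K. *)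
suff h : ((1 - q^-1)%:E * Ent <= (ln (Nq / N1))%:E)%E.
  apply: (@le_trans _ _ ((N1 / Nq)%:E * expeR (ln (Nq / N1))%:E)%E).
    apply: lee_wpmul2l; last by rewrite lee_expeR.
    by rewrite lee_fin divr_ge0// ltW.
  rewrite /= lnK ?posrE// -EFinM lee_fin mulrA divfK ?gt_eqF//.
  by rewrite divff ?gt_eqF.
apply: entropy_bound => //.
- exact: measurable_funM.
- by move=> x; rewrite divr_ge0 ?(ltW N10).
- under eq_integral do rewrite mulrC EFinM.
  rewrite ge0_integralZl_EFin//=; last exact/measurable_EFinP.
  by rewrite -intf -EFinM mulVf ?gt_eqF.
- transitivity (\int[mu]_x ((N1^-1 `^ q)%:E * (`|f x| `^ q)%:E))%E.
    by apply: eq_integral => x _; rewrite powRM// mulrC EFinM.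
  rewrite ge0_integralZl_EFin ?powR_ge0//=.
  + have <- : ((Nq `^ q)%:E = \int[mu]_x (`|f x| `^ q)%:E)%E by exact: intfq.
    by rewrite -EFinM mulrC -powRM// ltW.
  + exact/measurable_EFinP.
Qed.

Lemma le_pospow (R : realType) (s : R) (x y : \bar R) :
  0 <= s -> (x <= y)%E -> (pospow x s <= pospow y s)%E.
Proof.
move=> s0 xy; apply: gt0_ler_poweR => //.
- by rewrite in_itv/= le_max lexx leey.
- by rewrite in_itv/= le_max lexx leey.
- by rewrite ge_max !le_max lexx xy orbT.
Qed.

Lemma affine_deficit_le_log_deficit (R : realType) (n : nat)
    (f : 'rV[R]_n -> R) : (2 <= n)%N -> BV f -> ~ ae_zero f ->
  (affine_deficit f <= log_deficit f)%E.
Proof.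
move=> n2 [+ _] f0; rewrite inE => /andP[/=].
rewrite !inE/= => mf Nqoo.
have n1 : 1 < n%:R :> R by rewrite ltr1n.
have q1 : 1 < @sobolev_conj R n.
  by rewrite /sobolev_conj ltr_pdivlMr ?subr_gt0// mul1r gtrBl.
have qE : 1 - (@sobolev_conj R n)^-1 = n%:R^-1.
  by rewrite /sobolev_conj; field; rewrite subr_eq0 !gt_eqF// (lt_trans ltr01).
rewrite /affine_deficit; case: pselect => [//|nf0] /=; rewrite /log_deficit leeD2l//.
rewrite EFinN leeN2; case: ifPn => [_|N1]; first exact: lee01.
have := Lnorm_quotient_entropy_le1 q1 mf f0 Nqoo.
by rewrite ltey qE => /(_ N1).
Qed.

Theorem corollary5p4 (R : realType) (n : nat) (hn : (2 <= n)%N)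
    (alpha : R) (halpha : 0 < alpha)
    (hstab : forall g : 'rV[R]_n -> R, BV g ->
      (affine_dist g <=
       alpha%:E * pospow (affine_deficit g) (1680 * n%:R)^-1)%E)
    (f : 'rV[R]_n -> R) (hf : BV f) (hf0 : ~ ae_zero f) :
  (affine_dist f <= alpha%:E * pospow (log_deficit f) (1680 * n%:R)^-1)%E.
Proof.
apply: (le_trans (hstab f hf)); apply: lee_wpmul2l; first by rewrite lee_fin ltW.
have s0 : 0 <= (1680 * n%:R : R)^-1 by rewrite invr_ge0 mulr_ge0 ?ler0n.
exact: (le_pospow s0 (affine_deficit_le_log_deficit hn hf hf0)).
Qed.
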